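(* Let $C\subset\mathbb{R}^2$ be a plane convex body. Then every $C$-spindle convex set $K\subset\mathbb{R}^2$ satisfies Property (h) with respect to $C$; that is, for every line $H\subset\mathbb{R}^2$ with $H\cap\operatorname{int}K=\emptyset$, there is a translate of $C$ that separates $K$ from $H$.
   Context: A plane convex body is a compact convex set in $\mathbb{R}^2$ with non-empty interior. For $p,q\in\mathbb{R}^2$ (not necessarily distinct), the $C$-spindle $[p,q]_C$ is the intersection of all translates of $C$ that contain both $p$ and $q$ if there is such a translate, and $[p,q]_C=\mathbb{R}^2$ otherwise. A set $K\subset\mathbb{R}^2$ is $C$-spindle convex if $[p,q]_C\subset K$ for all $p,q\in K$. A translate $C+x$ of $C$ separates a set $X$ from a set $Y$ if $X\subset C+x$ and $\operatorname{int}(C+x)\cap Y=\emptyset$. Here $\operatorname{int}$ denotes the interior in $\mathbb{R}^2$.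
   Formalization: The claim fails when int K is empty and H has points of K strictly on both sides (e.g. C a square, K a segment parallel to a side), so for K with empty interior the conclusion is stated only for lines H that do not have points of K strictly on both sides. *)

(* Defs.v *)
From HB Require Import structures.
From mathcomp Require Import all_boot all_order all_algebra.
From mathcomp Require Import all_classical all_reals all_analysis.

Set Implicit Arguments.
Unset Strict Implicit.
Unset Printing Implicit Defensive.

Import Order.TTheory GRing.Theory Num.Theory.
Import numFieldNormedType.Exports.

Local Open Scope classical_set_scope.
Local Open Scope ring_scope.

(* The plane is 'rV[R]_2.  Its library norm is the sup norm, which induces the
   usual topology; only the topology is used below. *)

Definition plane_convex_body (R : realType) (C : set 'rV[R]_2) : Prop :=
  [/\ compact C, convex_set C & C° !=set0].

Definition translate (R : realType) (C : set 'rV[R]_2) (x : 'rV[R]_2) :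
    set 'rV[R]_2 :=
  [set c + x | c in C].

(* An intersection indexed by the empty set is setT, so the spindle of two points
   that lie in no common translate of C is the whole plane, as required
   (see spindle_no_translate). *)
Definition spindle (R : realType) (C : set 'rV[R]_2) (p q : 'rV[R]_2) :
    set 'rV[R]_2 :=
  \bigcap_(x in [set x | translate C x p /\ translate C x q]) translate C x.

Lemma spindle_no_translate (R : realType) (C : set 'rV[R]_2)
    (p q : 'rV[R]_2) :
  ~ (exists x, translate C x p /\ translate C x q) -> spindle C p q = setT.
Proof.
move=> nx; apply/seteqP; split=> // z _ x xpq.
by case: nx; exists x.
Qed.

Definition spindle_convex (R : realType) (C K : set 'rV[R]_2) : Prop :=
  forall p q, K p -> K q -> spindle C p q `<=` K.

Definition is_line (R : realType) (H : set 'rV[R]_2) : Prop :=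
  exists p v : 'rV[R]_2, v != 0 /\ H = [set p + t *: v | t in [set: R]].

Definition separates (R : realType) (D X Y : set 'rV[R]_2) : Prop :=
  X `<=` D /\ D° `&` Y = set0.

Definition property_h (R : realType) (C K : set 'rV[R]_2) : Prop :=
  forall H : set 'rV[R]_2, is_line H -> H `&` K° = set0 ->
    exists x : 'rV[R]_2, separates (translate C x) K H.

(* For a line H: K has points strictly on both sides of H.  If K has empty
   interior this is compatible with H `&` K° = set0, but it rules out every
   convex body containing K whose interior misses H.  Such sets K exist: for
   C the square [-1, 1]^2, the segment from (0, 0) to (1, 0) is C-spindle convex,
   has empty interior, and is cut by the line of abscissa 1/2. *)
Definition cuts (R : realType) (H K : set 'rV[R]_2) : Prop :=
  exists p q : 'rV[R]_2, [/\ K p, K q, ~ H p, ~ H q &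
    exists t : R, 0 <= t <= 1 /\ H ((1 - t) *: p + t *: q)].

(* Main.v *)
(* In the plane, let X be the set of x with p, q in C + x.  For every linear
   functional f there are x in X and s in [p,q]_C with f(x) + max_C f <= f(s);
   this is the planar core, and it needs only convexity: the chord of C through
   an f-maximal point y0 of C `&` (C - d), d = q - p, has length exactly |d|
   unless q itself can serve as s, and then moving y0 to an f-maximal point of
   C keeps all of C `&` (C - d) inside C.
   Applied to f and - f, this yields, for every p, q in K, a translation x with
   p, q in C + x and f(x) = sup_K f - max_C f.  So on that line of translations
   the compact intervals of the x with k in C + x, k in K, meet pairwise; by
   Helly's theorem in dimension one they have a common point x, and then K is
   included in C + x with max_(C + x) f = sup_K f. *)
Require Import Defs.
From HB Require Import structures.
From mathcomp Require Import all_boot all_order all_algebra.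
From mathcomp Require Import all_classical all_reals all_analysis.
From mathcomp Require Import ring lra.

Import Order.TTheory GRing.Theory Num.Theory.
Import numFieldNormedType.Exports.

Local Open Scope classical_set_scope.
Local Open Scope ring_scope.

(** * Linear functionals and determinants in the plane *)

Definition dot {R : realType} (u x : 'rV[R]_2) : R :=
  u 0 0 * x 0 0 + u 0 1 * x 0 1.

Lemma dotD (R : realType) (u x y : 'rV[R]_2) :
  dot u (x + y) = dot u x + dot u y.
Proof. by rewrite /dot !mxE; ring. Qed.

Lemma dotZ (R : realType) (u : 'rV[R]_2) (t : R) (x : 'rV[R]_2) :
  dot u (t *: x) = t * dot u x.
Proof. by rewrite /dot !mxE; ring. Qed.

Lemma dotN (R : realType) (u x : 'rV[R]_2) : dot u (- x) = - dot u x.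
Proof. by rewrite /dot !mxE; ring. Qed.

Lemma dotNl (R : realType) (u x : 'rV[R]_2) : dot (- u) x = - dot u x.
Proof. by rewrite /dot !mxE; ring. Qed.

Definition det2 {R : realType} (x y : 'rV[R]_2) : R :=
  x 0 0 * y 0 1 - x 0 1 * y 0 0.

Lemma row2P {R : realType} (x y : 'rV[R]_2) :
  x 0 0 = y 0 0 -> x 0 1 = y 0 1 -> x = y.
Proof.
move=> e0 e1; apply/rowP => -[[|[|//]] i2].
  by rewrite (_ : Ordinal i2 = 0) //; exact: val_inj.
by rewrite (_ : Ordinal i2 = 1) //; exact: val_inj.
Qed.

Lemma det_eq0_colinear {R : realType} (d w : 'rV[R]_2) :
  d != 0 -> det2 d w = 0 -> exists k, w = k *: d.
Proof.
rewrite /det2 => d0 /eqP; rewrite subr_eq0 => /eqP dw.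
have [d00|d00] := eqVneq (d 0 0) 0; last first.
  exists (w 0 0 / d 0 0); apply: row2P; rewrite !mxE; first by rewrite mulfVK.
  by apply: (mulfI d00); rewrite dw; field.
have d01 : d 0 1 != 0.
  by apply: contra_neq d0 => d01; apply: row2P; rewrite mxE.
exists (w 0 1 / d 0 1); apply: row2P; rewrite !mxE; last by rewrite mulfVK.
by apply: (mulfI d01); rewrite -dw d00; ring.
Qed.

Lemma det_neq0_span {R : realType} (d w x : 'rV[R]_2) :
  det2 d w != 0 -> exists m n, x = m *: d + n *: w.
Proof.
move=> D0; exists (det2 x w / det2 d w), (det2 d x / det2 d w).
by apply: row2P; rewrite !mxE; move: D0; rewrite /det2 => D0; field.
Qed.

Lemma continuous_dot (R : realType) (u : 'rV[R]_2) : continuous (dot u).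
Proof.
have h i : continuous (fun y : 'rV[R]_2 => u 0 i * y 0 i).
  by move=> x; apply: continuousM;
    [exact: cst_continuous | exact: coord_continuous].
by move=> x; exact: (continuousD (h 0 x) (h 1 x)).
Qed.

(** * Convexity, compactness and Helly's theorem on the line *)

Lemma convex_setE {R : realType} {C : set 'rV[R]_2} : convex_set C ->
  forall {x y} (t : R), C x -> C y -> 0 <= t <= 1 -> C ((1 - t) *: x + t *: y).
Proof.
move=> cC x y t Cx Cy /andP[t0 t1].
have := cC y x (Itv01 t0 t1).
by rewrite !inE /= => /(_ Cy Cx); rewrite /conv /= addrC.
Qed.

Lemma dot_max {R : realType} (u : 'rV[R]_2) (A : set 'rV[R]_2) :
  compact A -> A !=set0 ->
  exists2 c, A c & forall x, A x -> dot u x <= dot u c.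
Proof.
move=> cA A0.
have cf : {within A, continuous (dot u)}.
  by apply: continuous_subspaceT; exact: continuous_dot.
have [c] := EVT_max_rV A0 cA cf.
rewrite inE => Ac cmax; exists c => // x Ax; apply: cmax; exact: mem_set.
Qed.

(** The supremum of all lower bounds of the [F i] works: as the sets meet pairwise, a lower bound of
    one is at most some point of any other. *)
Lemma helly_intervals {R : realType} {I : Type} (A : set I) (F : I -> set R) :
  (forall i, A i -> compact (F i)) -> (forall i, A i -> is_interval (F i)) ->
  (forall i j, A i -> A j -> F i `&` F j !=set0) ->
  exists a, forall i, A i -> F i a.
Proof.
move=> cF iF mF.
have [[i0 Ai0]|A0] := pselect (A !=set0); last first.
  by exists 0 => i Ai; case: A0; exists i.
have bnd i : A i ->
    exists a b, [/\ F i a, F i b & forall t, F i t -> a <= t <= b].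
  move=> Ai; have F0 : F i !=set0 by have [x [? _]] := mF i i Ai Ai; exists x.
  have cid : {within F i, continuous (@idfun R)}.
    by apply: continuous_subspaceT => x; exact: cvg_id.
  have [a Fa amin] := compact_EVT_min F0 (cF i Ai) cid.
  have [b Fb bmax] := compact_EVT_max F0 (cF i Ai) cid.
  rewrite !inE in Fa Fb; exists a, b; split=> // t Ft.
  by rewrite amin ?bmax // inE.
pose L := [set t | exists2 i, A i & forall s, F i s -> t <= s].
have LF i t : A i -> L t -> exists2 b, F i b & t <= b.
  move=> Ai [j Aj tle]; have [s [Fi Fj]] := mF i j Ai Aj.
  by exists s => //; exact: tle.
have L0 : L !=set0.
  have [a [b [_ _ ab]]] := bnd i0 Ai0.
  by exists a, i0 => // s /ab /andP[].
exists (sup L) => i Ai.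
have [a [b [Fa Fb ab]]] := bnd i Ai.
have Lb : ubound L b.
  by move=> t /(LF i t Ai)[s Fs ts]; apply: (le_trans ts); case/andP: (ab s Fs).
apply: (iF i Ai a b) => //; rewrite ge_sup // andbT.
apply: ub_le_sup; first by exists b.
by exists i => // s /ab /andP[].
Qed.

Lemma div1D_itv {R : realType} (t : R) : 0 <= t -> 0 <= t / (1 + t) <= 1.
Proof. by move=> t0; rewrite divr_ge0 ?ler_pdivrMr; lra. Qed.

(** * Chords of [C] in the direction [d] *)

Section Chords.
Context {R : realType} (C : set 'rV[R]_2) (u d y0 c : 'rV[R]_2).
Local Notation f := (dot u).
Hypothesis cC : convex_set C.
Hypotheses (Cy0 : C y0) (Cy0d : C (y0 + d)) (Cc : C c).
Hypothesis y0max : forall y, C y -> C (y + d) -> f y <= f y0.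
(* If [f (y0 + d)] were the maximum of f on C, the translation by d would do. *)
Hypotheses (fd : 0 <= f d) (fc : f (y0 + d) < f c).

(** If s < 0, the homothety of centre [c] and ratio 1 - e = 1 / (1 - s) shrinks the chord from y0 +
    s d to y0 + d to a translate of d inside [C]. Its initial point is strictly higher than y0,
    against [y0max]. *)
Lemma chord_ge0 s : C (y0 + s *: d) -> 0 <= s.
Proof.
move=> Cs; rewrite leNgt; apply/negP => s0.
move: (fd) fc; rewrite dotD => fd1 fc1.
pose e := - s / (1 - s).
have e0 : 0 < e by apply: divr_gt0; lra.
have e1 : e < 1 by rewrite /e ltr_pdivrMr; lra.
have e01 : 0 <= e <= 1 by lra.
have Cz := convex_setE cC e Cs Cc e01.
have Cw := convex_setE cC e Cy0d Cc e01.
have E : (1 - e) *: (y0 + d) + e *: c = (1 - e) *: (y0 + s *: d) + e *: c + d.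
  by apply/rowP => i; rewrite !mxE /e; field; lra.
rewrite E in Cw; have := y0max _ Cz Cw.
have : 0 < e * (f c - f y0 - f d) by apply: mulr_gt0 => //; lra.
rewrite !(dotD, dotZ).
have -> : (1 - e) * (f y0 + s * f d) = (1 - e) * f y0 - e * f d.
  by rewrite /e; field; lra.
lra.
Qed.

(** Same homothety argument for the chord from y0 to y0 + s d, with ratio 1 - e = 1 / s. *)
Lemma chord_le1 s : C (y0 + s *: d) -> s <= 1.
Proof.
move=> Cs; rewrite leNgt; apply/negP => s1.
move: (fd) fc; rewrite dotD => fd1 fc1.
pose e := 1 - s^-1.
have sV0 : 0 < s^-1 by rewrite invr_gt0; lra.
have sV1 : s^-1 < 1 by rewrite invf_lt1; lra.
have e0 : 0 < e by rewrite /e; lra.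
have e01 : 0 <= e <= 1 by rewrite /e; lra.
have Cz := convex_setE cC e Cy0 Cc e01.
have Cw := convex_setE cC e Cs Cc e01.
have E : (1 - e) *: (y0 + s *: d) + e *: c = (1 - e) *: y0 + e *: c + d.
  by apply/rowP => i; rewrite !mxE /e; field; lra.
rewrite E in Cw; have := y0max _ Cz Cw; rewrite !(dotD, dotZ).
have : 0 < e * (f c - f y0) by apply: mulr_gt0; lra.
lra.
Qed.

(** Apart from degenerate cases, write c - y0 = m d + n (y0 - y). For n >= 0 convexity reaches the
    target point; for n < 0 a chord of vector d starting above y0 appears. *)
Lemma chord_translate y : C y -> C (y + d) -> C (y + (c - y0)).
Proof.
move=> Cy Cyd; have fy := y0max _ Cy Cyd.
move: (fd) fc; rewrite dotD => fd1 fc1.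
have [d0|d0] := eqVneq d 0.
  by have := y0max _ Cc; rewrite d0 addr0 => /(_ Cc); lra.
have [D0|D0] := eqVneq (det2 d (y0 - y)) 0.
  have [k kE] := det_eq0_colinear _ _ d0 D0.
  have {}kE : y = y0 - k *: d by rewrite -kE subKr.
  have /chord_ge0 : C (y0 + (- k) *: d) by rewrite scaleNr -kE.
  have /chord_le1 : C (y0 + (1 - k) *: d).
    by rewrite scalerBl scale1r addrCA addrC -kE in Cyd *.
  move=> k1 k0; have k00 : k = 0 by lra.
  by rewrite kE k00 scale0r subr0 addrC subrK.
have [m [n cE]] := det_neq0_span _ _ (c - y0) D0.
have {}cE : c = y0 + m *: d + n *: (y0 - y) by rewrite -addrA -cE addrC subrK.
have fcE : f c = f y0 + m * f d + n * (f y0 - f y).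
  by rewrite {1}cE !(dotD, dotZ, dotN).
(* The segments from y and from y + d to c cross the chord through y0 at the
   parameters m / (1 + n) and 1 + (m - 1) / (1 + n): hence 0 <= m <= 1. *)
have [n0|n0] := leP 0 n.
  have t01 : 0 <= (1 + n)^-1 <= 1.
    by rewrite invr_ge0 invf_le1; lra.
  have /chord_ge0 : C (y0 + (m / (1 + n)) *: d).
    have := convex_setE cC _ Cy Cc t01.
    congr C; apply/rowP => i; rewrite cE !mxE; field; lra.
  have /chord_le1 : C (y0 + (1 + (m - 1) / (1 + n)) *: d).
    have := convex_setE cC _ Cyd Cc t01.
    congr C; apply/rowP => i; rewrite cE !mxE; field; lra.
  rewrite gerDl pmulr_lle0 ?invr_gt0 ?pmulr_lge0 ?invr_gt0; [|lra|lra].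
  move=> m1 m0.
  have Cym : C (y + m *: d).
    have m01 : 0 <= m <= 1 by lra.
    have := convex_setE cC _ Cy Cyd m01.
    congr C; apply/rowP => i; rewrite !mxE; ring.
  (* The target y + (c - y0) lies on the segment from y + m d to c, at parameter n / (1 + n). *)
  have l01 := div1D_itv _ n0.
  have := convex_setE cC _ Cym Cc l01.
  congr C; apply/rowP => i; rewrite cE !mxE; field; lra.
exfalso.
have [n1|n1] := leP (- n) 1.
  have n01 : 0 <= - n <= 1 by lra.
  have m1 : 1 < m.
    have : n * (f y0 - f y) <= 0 by apply: mulr_le0_ge0; lra.
    move=> h; rewrite ltNge; apply/negP => m1.
    have : m * f d <= 1 * f d by apply: ler_wpM2r.
    lra.
  (* The point c - m d lies on the segment from y0 to y; as m > 1, c - d is in [C] and starts a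
     chord of vector d ending at c. *)
  have Ca := convex_setE cC _ Cy0 Cy n01.
  have mV : 0 <= m^-1 <= 1 by rewrite invr_ge0 invf_le1; lra.
  have Ccd : C (c - d).
    have m01 : 0 <= 1 - m^-1 <= 1 by lra.
    have := convex_setE cC _ Ca Cc m01.
    congr C; apply/rowP => i; rewrite cE !mxE; field; lra.
  have := y0max _ Ccd; rewrite subrK => /(_ Cc); rewrite dotD dotN; lra.
have m1 : 1 < m.
  have : n * (f y0 - f y) <= 0 by apply: mulr_le0_ge0; lra.
  move=> h; rewrite ltNge; apply/negP => m1.
  have : m * f d <= 1 * f d by apply: ler_wpM2r.
  lra.
(* The segment from y0 + d to c meets the line through y in direction d at y + (1 + h) d, so a chord
   of vector d starts at y + h d. *)
pose h := (m - 1) / - n.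
have h0 : 0 < h by apply: divr_gt0; lra.
have nV : 0 <= (- n)^-1 <= 1 by rewrite invr_ge0 invf_le1; lra.
have Cyh1 : C (y + (1 + h) *: d).
  have := convex_setE cC _ Cy0d Cc nV.
  congr C; apply/rowP => i; rewrite cE !mxE /h; field; lra.
have Cyh : C (y + h *: d).
  have h01 := div1D_itv _ (ltW h0).
  have := convex_setE cC _ Cy Cyh1 h01.
  congr C; apply/rowP => i; rewrite !mxE; field; lra.
have := y0max _ Cyh.
have -> : y + h *: d + d = y + (1 + h) *: d.
  by rewrite -addrA scalerDl scale1r (addrC d).
move=> /(_ Cyh1); rewrite dotD dotZ => fh.
have : - n * (f y + h * f d) <= - n * f y0 by apply: ler_wpM2l; lra.
have -> : - n * (f y + h * f d) = - n * f y + (m - 1) * f d.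
  by rewrite /h; field; lra.
lra.
Qed.
End Chords.

(** * The orthogonal coordinates [dot u] and [dot (perp u)] *)

Definition perp {R : realType} (v : 'rV[R]_2) : 'rV[R]_2 :=
  \row_j (if j == 0 then - v 0 1 else v 0 0).

Lemma dot_perp {R : realType} (v x : 'rV[R]_2) : dot (perp v) x = det2 v x.
Proof. by rewrite /dot /det2 !mxE /=; ring. Qed.

Lemma perp_neq0 {R : realType} (v : 'rV[R]_2) : v != 0 -> perp v != 0.
Proof.
apply: contra_neq => v0; have := congr1 (fun M : 'rV_2 => M 0 0) v0.
have := congr1 (fun M : 'rV_2 => M 0 1) v0; rewrite !mxE /= => v00 v01.
by apply: row2P; rewrite !mxE //; apply: oppr_inj; rewrite oppr0.
Qed.

Lemma dot_gt0 {R : realType} (u : 'rV[R]_2) : u != 0 -> 0 < dot u u.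
Proof.
move=> u0; rewrite lt_neqAle addr_ge0 ?sqr_ge0 // andbT eq_sym.
apply: contra_neq u0 => /eqP; rewrite /dot -!expr2.
by rewrite paddr_eq0 ?sqr_ge0 // !sqrf_eq0 => /andP[/eqP ? /eqP ?];
  apply: row2P; rewrite mxE.
Qed.

Lemma dot_surj {R : realType} (u : 'rV[R]_2) (h : R) :
  u != 0 -> exists x, dot u x = h.
Proof.
move=> u0; exists ((h / dot u u) *: u).
by rewrite dotZ mulfVK // gt_eqF // dot_gt0.
Qed.

Lemma dot_perp_inj {R : realType} (u x y : 'rV[R]_2) : u != 0 ->
  dot u x = dot u y -> dot (perp u) x = dot (perp u) y -> x = y.
Proof.
move=> u0 uxy pxy; apply/eqP; rewrite -subr_eq0; apply/eqP.
have [|k E] := det_eq0_colinear u (x - y) u0.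
  by rewrite -dot_perp dotD dotN pxy subrr.
have : dot u (x - y) = 0 by rewrite dotD dotN uxy subrr.
rewrite E dotZ => /eqP; rewrite mulf_eq0 (gt_eqF (dot_gt0 _ u0)) orbF.
by move=> /eqP ->; rewrite scale0r.
Qed.

(** * Spindles in a given direction, and a translate covering [K] *)

Lemma translateE {R : realType} (C : set 'rV[R]_2) (x z : 'rV[R]_2) :
  translate C x z = C (z - x).
Proof.
apply/propext; split=> [[c Cc <-]|Cz]; first by rewrite addrK.
by exists (z - x); rewrite ?subrK.
Qed.

Lemma spindleC {R : realType} (C : set 'rV[R]_2) (p q : 'rV[R]_2) :
  spindle C p q = spindle C q p.
Proof. by rewrite /spindle; congr bigcap; apply/seteqP; split=> x []. Qed.

Lemma spindle_support {R : realType} {C : set 'rV[R]_2} (u : 'rV[R]_2)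
    {p q : 'rV[R]_2} : compact C -> convex_set C ->
  (exists x, translate C x p /\ translate C x q) ->
  exists x s, [/\ translate C x p, translate C x q, spindle C p q s &
    forall c, C c -> dot u x + dot u c <= dot u s].
Proof.
move=> kC cC; wlog pq : p q / 0 <= dot u (q - p).
  move=> hw [x [xp xq]].
  have [pq|/ltW pq] := leP 0 (dot u (q - p)).
    by apply: hw => //; exists x.
  have [||y [s [yq yp ss ys]]] := hw q p; last by exists y, s; rewrite spindleC.
    by rewrite -opprB dotN oppr_ge0.
  by exists x.
move=> [x [+ +]]; rewrite !translateE => xp xq.
(* By y = p - x, [Y] parametrizes the translations x such that C + x contains p and q; maximizing on
   [Y] makes x lowest. *)
pose Y := C `&` (fun y => y + (q - p)) @^-1` C.
have kY : compact Y.
  apply: compact_closedI => //.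
  apply: preimage_closed; last first.
    by apply: compact_closed => //; exact: norm_hausdorff.
  by move=> y _; apply: (@continuousD _ _ _ id (cst (q - p)));
    [exact: cvg_id|exact: cst_continuous].
have [|y0 [Cy0 Cy0d] y0max] := dot_max u Y kY.
  by exists (p - x); split=> //=; rewrite addrC addrA subrK.
have [|c Cc cmax] := dot_max u C kC; first by exists (p - x).
have Xq : q - (p - y0) = y0 + (q - p) by rewrite opprB addrCA.
have [fc|fc] := leP (dot u c) (dot u (y0 + (q - p))).
  exists (p - y0), q; rewrite !translateE Xq subKr; split=> //.
    by move=> z [_].
  by move=> c' /cmax; move: fc; rewrite !(dotD, dotN); lra.
(* The witness s is the top point x + c of the lowest translate; [chord_translate] puts it in every
   translate containing p and q. *)
exists (p - y0), (p + c - y0); rewrite !translateE Xq subKr; split=> //.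
  move=> z [+ +] /=; rewrite !translateE => zp zq.
  have -> : p + c - y0 - z = (p - z) + (c - y0).
    by apply/rowP => i; rewrite !mxE; ring.
  apply: (chord_translate C u (q - p) y0 c) => //.
    by move=> y Cy Cyd; apply: y0max.
  by rewrite [X in C X](_ : _ = q - z) //; rewrite addrC addrA subrK.
by move=> c' /cmax; rewrite !(dotD, dotN); lra.
Qed.

(** Here [M] is the maximum on [C] and [S] the supremum on [K]. The translations x with p and q in C
    + x form a convex set, so it suffices to find one at height at most S - M and one at height at
    least S - M. *)
Lemma spindle_level {R : realType} (C K : set 'rV[R]_2) (u p q : 'rV[R]_2)
    (M S : R) : compact C -> convex_set C -> spindle_convex C K ->
  (forall a b, K a -> K b -> exists x, translate C x a /\ translate C x b) ->
  (forall c, C c -> dot u c <= M) -> (exists2 c, C c & dot u c = M) ->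
  (forall k, K k -> dot u k <= S) ->
  (forall T, (forall k, K k -> dot u k <= T) -> S <= T) ->
  K p -> K q ->
  exists x, [/\ translate C x p, translate C x q & dot u x = S - M].
Proof.
move=> kC cC sK pK CM [c Cc cM] KS SK Kp Kq.
have pq := pK p q Kp Kq.
have [x [s [xp xq xs /(_ c Cc) xM]]] := spindle_support u kC cC pq.
have [y [t [yp yq yt yM]]] := spindle_support (- u) kC cC pq.
have xSM : dot u x <= S - M.
  by have := KS s (sK p q Kp Kq s xs); lra.
have ySM : S - M <= dot u y.
  rewrite lerBlDr; apply: SK => k Kk.
  (* A translate C + z containing k and the low point t of the spindle is no higher than C + y, so k
     is at height at most dot u y + M. *)
  have [z [+ +]] := pK k t Kk (sK p q Kp Kq t yt); rewrite !translateE => zk zt.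
  by have := yM _ zt; have := CM _ zk; rewrite !dotNl !dotD !dotN; lra.
have [t0 t01 tE] : exists2 t0, 0 <= t0 <= 1 &
    (1 - t0) * dot u x + t0 * dot u y = S - M.
  have [xy|xy] := eqVneq (dot u x) (dot u y).
    by exists 0; lra.
  have xy' : dot u x < dot u y by rewrite lt_neqAle xy; lra.
  exists ((S - M - dot u x) / (dot u y - dot u x)).
    by rewrite divr_ge0 ?ler_pdivrMr; lra.
  by field; lra.
exists ((1 - t0) *: x + t0 *: y); move: xp xq yp yq; rewrite !translateE.
move=> xp xq yp yq; split; last by rewrite dotD !dotZ.
  have := convex_setE cC _ xp yp t01.
  by congr C; apply/rowP => i; rewrite !mxE; ring.
have := convex_setE cC _ xq yq t01.
by congr C; apply/rowP => i; rewrite !mxE; ring.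
Qed.

(** The bound on [dot u x] keeps the whole translate in the half-plane where [dot u] is at most
    [h]. *)
Lemma translate_cover {R : realType} {C K : set 'rV[R]_2} {u : 'rV[R]_2}
    {M h : R} : u != 0 -> compact C -> convex_set C -> spindle_convex C K ->
  (forall c, C c -> dot u c <= M) -> (exists2 c, C c & dot u c = M) ->
  (forall k, K k -> dot u k <= h) ->
  exists2 x, K `<=` translate C x & dot u x <= h - M.
Proof.
move=> u0 kC cC sK CM cM Kh.
have [[k0 Kk0]|K0] := pselect (K !=set0); last first.
  have [x xE] := dot_surj u (h - M) u0.
  by exists x; rewrite ?xE // => k Kk; case: K0; exists k.
have pK a b : K a -> K b -> exists x, translate C x a /\ translate C x b.
  (* Otherwise the spindle, hence [K], would be the whole plane, on which [dot u] exceeds [h]. *)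
  move=> Ka Kb; apply: contrapT => /spindle_no_translate ab.
  have [x xE] := dot_surj u (h + 1) u0.
  have := Kh x (sK a b Ka Kb x _); rewrite ab xE => /(_ I); lra.
pose S := sup (dot u @` K).
have supK : has_sup (dot u @` K).
  by split; [exists (dot u k0), k0 | exists h => _ [k /Kh ? <-]].
have KS k : K k -> dot u k <= S.
  by move=> Kk; apply: sup_upper_bound => //; exists k.
have SK T : (forall k, K k -> dot u k <= T) -> S <= T.
  by move=> KT; apply: ge_sup; [case: supK | move=> _ [k /KT ? <-]].
(* Translations at height S - M whose translate contains k; [dot (perp u)] maps them to an interval,
   where Helly's theorem applies. *)
pose X k := [set k - c | c in C] `&` dot u @^-1` [set S - M].
have XE k x : X k x <-> translate C x k /\ dot u x = S - M.
  rewrite translateE; split=> [[[c Cc <-] ?]|[Cx ?]]; first by rewrite subKr.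
  by split=> //; exists (k - x); rewrite ?subKr.
have [k Kk|k Kk|k l Kk Kl|a aX] :=
    helly_intervals K (fun k => dot (perp u) @` X k).
- apply: continuous_compact.
    by apply: continuous_subspaceT; exact: continuous_dot.
  apply: compact_closedI.
    apply: continuous_compact => //; apply: continuous_subspaceT => c.
    by apply: (@continuousB _ _ _ (cst k) id);
      [exact: cst_continuous|exact: cvg_id].
  apply: (@preimage_closed _ _ (dot u) [set S - M]); last exact: closed_eq.
  by move=> x _; exact: continuous_dot.
- move=> _ _ [x /XE[xk xE] <-] [y /XE[yk yE] <-] t /andP[xt ty].
  have [xy|xy] := eqVneq (dot (perp u) x) (dot (perp u) y).
    exists x; first exact: (XE _ _).2.
    by apply: le_anti; rewrite xt xy ty.
  have xy' : dot (perp u) x < dot (perp u) y.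
    by rewrite lt_neqAle xy; lra.
  pose s := (t - dot (perp u) x) / (dot (perp u) y - dot (perp u) x).
  have s01 : 0 <= s <= 1 by rewrite divr_ge0 ?ler_pdivrMr; lra.
  exists ((1 - s) *: x + s *: y); last by rewrite dotD !dotZ /s; field; lra.
  apply: (XE _ _).2; move: xk yk; rewrite !translateE dotD !dotZ xE yE => xk yk.
  split; last ring.
  have := convex_setE cC _ xk yk s01.
  by congr C; apply/rowP => i; rewrite !mxE; ring.
- have [x [xk xl xE]] :=
    spindle_level C K u k l M S kC cC sK pK CM cM KS SK Kk Kl.
  by exists (dot (perp u) x); split; exists x => //;
    apply: (XE _ _).2.
have [x /XE[_ xE] xa] := aX k0 Kk0.
exists x; last by rewrite xE lerB // SK.
move=> k /aX[y /XE[yk yE] ya].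
rewrite (dot_perp_inj u x y) ?xE ?yE // xa; exact/esym.
Qed.

(** * Interior points and convex sets on one side of a line *)

Lemma interior_ray {R : realType} {A : set 'rV[R]_2} {z : 'rV[R]_2}
    (w : 'rV[R]_2) : A° z -> exists2 e, 0 < e & A (z + e *: w).
Proof.
move=> Az.
have cw : {for 0, continuous (cst z + (fun e : R => e *: w))}.
  by apply: continuousD; [exact: cst_continuous|exact: scalel_continuous].
have := cw A; rewrite {1}/GRing.add /= scale0r addr0.
move=> /(_ Az)/nbhs_ballP[e /= e0 eA].
exists (e / 2); first by rewrite divr_gt0.
by apply: eA; rewrite /ball /= sub0r normrN gtr0_norm ?divr_gt0 //; lra.
Qed.

(** The segment from [o] to a point k above level [h] would cross that level at an interior
    point. *)
Lemma interior_convex_line {R : realType} {K : set 'rV[R]_2}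
    {u o : 'rV[R]_2} {h : R} :
  (forall x y (t : R), K x -> K y -> 0 <= t <= 1 ->
    K ((1 - t) *: x + t *: y)) ->
  K° o -> dot u o < h -> (forall z, K° z -> dot u z <> h) ->
  forall k, K k -> dot u k <= h.
Proof.
move=> cK Ko oh Kh k Kk; rewrite leNgt; apply/negP => hk.
pose t := (h - dot u o) / (dot u k - dot u o).
have t0 : 0 <= t by rewrite divr_ge0; lra.
have t1 : t < 1 by rewrite ltr_pdivrMr; lra.
apply: (Kh ((1 - t) *: o + t *: k)); last first.
  by rewrite dotD !dotZ /t; field; lra.
(* Inverse of the homothety of centre k and ratio 1 - t, which carries a neighbourhood of [o] in [K]
   to one of the crossing point. *)
pose g (w : 'rV[R]_2) := (1 - t)^-1 *: (w - t *: k).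
have tN : 1 - t != 0 by rewrite gt_eqF //; lra.
have gE : g ((1 - t) *: o + t *: k) = o by rewrite /g addrK scalerK.
have cg : continuous g.
  move=> w; apply: (@continuous_comp _ _ _ (id - cst (t *: k))).
    by apply: continuousB; [exact: cvg_id|exact: cst_continuous].
  exact: scaler_continuous.
have gK : nbhs ((1 - t) *: o + t *: k) (g @^-1` K) by apply: cg; rewrite gE.
apply: filterS gK => w Kw.
have -> : w = (1 - t) *: g w + t *: k by rewrite /g scalerKV // subrK.
by apply: cK => //; lra.
Qed.

Lemma spindle_convex_segment {R : realType} {C K : set 'rV[R]_2} :
  convex_set C -> spindle_convex C K ->
  forall x y (t : R), K x -> K y -> 0 <= t <= 1 -> K ((1 - t) *: x + t *: y).
Proof.
move=> cC sK x y t Kx Ky t01; apply: (sK x y) => // z [].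
rewrite !translateE => zx zy; have := convex_setE cC _ zx zy t01.
by congr C; apply/rowP => i; rewrite !mxE; ring.
Qed.

(** * Lines as level sets, and separation *)

Lemma line_dotE {R : realType} (p v z : 'rV[R]_2) : v != 0 ->
  [set p + t *: v | t in [set: R]] z <-> dot (perp v) z = dot (perp v) p.
Proof.
move=> v0; split=> [[t _ <-]|zp].
  by rewrite dotD dotZ (dot_perp v v) /det2; ring.
have [|t tE] := det_eq0_colinear v (z - p) v0.
  by rewrite -dot_perp dotD dotN zp subrr.
by exists t; rewrite // -tE addrC subrK.
Qed.

Lemma separates_halfplane {R : realType} {C K H : set 'rV[R]_2}
    (u : 'rV[R]_2) (h : R) : plane_convex_body C -> spindle_convex C K ->
  u != 0 -> (forall z, H z -> dot u z = h) -> (forall k, K k -> dot u k <= h) ->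
  exists x, separates (translate C x) K H.
Proof.
move=> [kC cC [c0 /interior_subset Cc0]] sK u0 Hh Kh.
have [|c Cc cmax] := dot_max u C kC; first by exists c0.
have cM : exists2 c', C c' & dot u c' = dot u c by exists c.
have [x Kx xh] := translate_cover u0 kC cC sK cmax cM Kh.
(* An interior point of the translate on [H], pushed along [u], would leave the half-plane
   containing the translate. *)
exists x; split=> //; rewrite -subset0 => z [/(interior_ray u)[e e0 +] /Hh zh].
rewrite translateE => /cmax; rewrite !(dotD, dotN, dotZ) zh.
by have := mulr_gt0 e0 (dot_gt0 _ u0); lra.
Qed.

Theorem theorem4 (R : realType) (C K : set 'rV[R]_2)
    (hC : plane_convex_body C) (hK : spindle_convex C K) :
  (K° !=set0 -> property_h C K) /\
  (K° = set0 ->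
    forall H : set 'rV[R]_2, is_line H -> ~ cuts H K ->
      exists x : 'rV[R]_2, separates (translate C x) K H).
Proof.
have [_ cC _] := hC; have cK := spindle_convex_segment cC hK.
(* It remains to place [K] in a closed half-plane bounded by the line: an interior point decides the
   side in the first case, the absence of a cut in the second. *)
suff halfplane (p v : 'rV[R]_2) : v != 0 ->
    (forall k, K k -> dot (perp v) k <= dot (perp v) p) \/
    (forall k, K k -> dot (perp v) p <= dot (perp v) k) ->
    exists x, separates (translate C x) K [set p + t *: v | t in [set: R]].
  split=> [[w Kw] H [p [v [v0 ->]]] HK | _ H [p [v [v0 ->]]] nc].
    apply: halfplane => //.
    have nh z : K° z -> dot (perp v) z <> dot (perp v) p.
      move=> Kz /(line_dotE _ _ _ v0) Hz.
      by have := conj Hz Kz; rewrite -[_ /\ _]/((_ `&` _) z) HK.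
    have [wh|wh|/(nh _ Kw) //] := ltgtP (dot (perp v) w) (dot (perp v) p).
      by left; exact: interior_convex_line cK Kw wh nh.
    right=> k Kk; rewrite -lerN2 -!dotNl.
    apply: interior_convex_line cK Kw _ _ _ Kk => //.
      by rewrite !dotNl ltrN2.
    by move=> z /nh zh; rewrite !dotNl => /oppr_inj.
  apply: halfplane => //; apply: contrapT => /not_orP[].
  move=> /existsNP[q /not_implyP[Kq /negP]].
  rewrite -ltNge => hq /existsNP[r /not_implyP[Kr /negP]].
  rewrite -ltNge => hr; apply: nc; exists r, q; split=> //.
  - by move=> /(line_dotE _ _ _ v0); lra.
  - by move=> /(line_dotE _ _ _ v0); lra.
  (* Parameter at which the segment from r to q crosses the line. *)
  exists ((dot (perp v) p - dot (perp v) r) /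
          (dot (perp v) q - dot (perp v) r)).
  split; first by rewrite divr_ge0 ?ler_pdivrMr; lra.
  by apply/(line_dotE _ _ _ v0); rewrite dotD !dotZ; field; lra.
move=> v0 [Kh|Kh].
  apply: (separates_halfplane (perp v) (dot (perp v) p)) => //.
    exact: perp_neq0.
  by move=> z /(line_dotE _ _ _ v0).
apply: (separates_halfplane (- perp v) (- dot (perp v) p)) => //.
- by rewrite oppr_eq0 perp_neq0.
- by move=> z /(line_dotE _ _ _ v0); rewrite dotNl => ->.
- by move=> k /Kh; rewrite dotNl lerN2.
Qed.
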